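(* Let $G$ be a cubic graph of order $2n$ (i.e. with $2n$ vertices). Then the number of perfect matchings of $G$ equals the expected value $$\operatorname{PerMat}(G) = \operatorname{E}(X),$$ where $X$ is the random variable defined on the set of all $2$-colorings $c$ of the edges of $G$, each coloring being equally likely, by $X(c) = (-3)^{m_c}$, where $m_c$ is the number of vertices of $G$ that are incident in $c$ with three edges of the same color.
   Context: Graphs are finite. $\operatorname{PerMat}(G)$ denotes the number of perfect matchings of $G$. A $2$-coloring of the edges is an arbitrary map from the edge set $E(G)$ to a fixed set of two colors (not required to be proper); since $|E(G)|=3n$, there are $2^{3n}$ of them, and the expectation is over the uniform distribution on these. *)

(* Defs.v *)
From mathcomp Require Import all_boot all_order all_algebra.

Set Implicit Arguments.
Unset Strict Implicit.
Unset Printing Implicit Defensive.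

Import GRing.Theory Num.Theory.

Local Open Scope ring_scope.

(* Parallel edges (ends not injective) and loops (#|ends e| = 1) are allowed;
   a simple graph is the case where ends is injective with values of
   cardinality 2. *)
Record graph := Graph {
  vertex : finType;
  edge : finType;
  ends : edge -> {set vertex};
  ends_card : forall e, (0 < #|ends e| <= 2)%N
}.

Section GraphTheory.
Variable G : graph.
Implicit Types (v : vertex G) (e : edge G) (A M : {set edge G}).

(* A loop counts twice at its vertex. *)
Definition incidence v e : nat :=
  if v \in ends e then (if #|ends e| == 1%N then 2 else 1)%N else 0%N.

Definition degree_in A v : nat := (\sum_(e in A) incidence v e)%N.

Definition degree v : nat := degree_in [set: edge G] v.

Definition cubic : Prop := forall v, degree v = 3%N.

(* No loop can belong to a perfect matching, as it counts twice in the
   degree. *)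
Definition perfect_matching M : bool := [forall v, degree_in M v == 1%N].

Definition PerMat : nat := #|[set M | perfect_matching M]|.

Definition coloring : finType := {ffun edge G -> bool}.

Definition monochromatic (c : coloring) v : bool :=
  [exists k : bool, degree_in [set e | c e == k] v == 3%N].

Definition num_monochromatic (c : coloring) : nat :=
  #|[set v | monochromatic c v]|.

End GraphTheory.

Definition uniform_expectation (T : finType) (X : T -> rat) : rat :=
  (\sum_(t : T) X t) / #|T|%:R.

(* Main.v *)
(* Let s_e = 1 or -1 be the sign of the color of e.  At a vertex whose three
   edge-ends carry signs a, b, c, the product abc(a + b + c) is 3 if a = b = c
   and -1 otherwise, so X(c) is the product over all vertices of
   -abc(a + b + c).  The minus signs cancel because the order is even, and the
   factors abc cancel because every edge has two ends.  Expanding the remaining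
   product of sums a + b + c gives a sum over the maps f choosing an edge-end at
   each vertex; the expectation of the product of the signs chosen is 1 if every
   edge is chosen an even number of times and 0 otherwise.  As an edge has at
   most two end vertices, the former holds exactly when the chosen edges form a
   perfect matching, and f is determined by that matching. *)
Require Import Defs.
From mathcomp Require Import all_boot all_order all_algebra.

Set Implicit Arguments.
Unset Strict Implicit.
Unset Printing Implicit Defensive.

Import GRing.Theory Num.Theory.

Local Open Scope ring_scope.

Section Incidence.
Variable G : graph.
Implicit Types (v : vertex G) (e : edge G) (M : {set edge G}).

Lemma incidence_gt0 v e : (0 < incidence v e)%N = (v \in ends e).
Proof. by rewrite /incidence; case: ifP => //; case: ifP. Qed.

Lemma sum_incidence e : (\sum_v incidence v e)%N = 2%N.
Proof.
rewrite /incidence -big_mkcond sum_nat_const.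
have := ends_card e.
by case: #|ends e| => [|[|[|k]]].
Qed.

Lemma degree_in_ge M v e : e \in M -> (incidence v e <= degree_in M v)%N.
Proof. by move=> eM; rewrite /degree_in (bigD1 e) //= leq_addr. Qed.

Lemma perfect_matching_incidence M v e :
  perfect_matching M -> e \in M -> v \in ends e -> incidence v e = 1%N.
Proof.
move=> /forallP/(_ v)/eqP deg1 eM; rewrite -incidence_gt0 => inc_gt0.
by apply/eqP; rewrite eqn_leq inc_gt0 -deg1 degree_in_ge.
Qed.

Lemma perfect_matching_uniq M v e e' :
    perfect_matching M -> e \in M -> e' \in M ->
  v \in ends e -> v \in ends e' -> e = e'.
Proof.
move=> pmM eM e'M ve ve'; apply/eqP; apply: contraT => neq_ee'.
have /forallP/(_ v)/eqP := pmM.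
rewrite /degree_in (bigD1 e) //= (bigD1 e') /=; last by rewrite e'M eq_sym.
by rewrite !(perfect_matching_incidence pmM).
Qed.

Lemma perfect_matching_card_ends M e :
  perfect_matching M -> e \in M -> #|ends e| = 2%N.
Proof.
move=> pmM eM; have /andP[/card_gt0P[v ve] le2] := ends_card e.
have := perfect_matching_incidence pmM eM ve.
rewrite /incidence ve; move: le2 (ends_card e).
by case: #|ends e| => [|[|[|k]]].
Qed.

End Incidence.

Section EdgeChoice.
Variable G : graph.
Variable f : {ffun vertex G -> edge G}.
Hypothesis f_inc : forall v, v \in ends (f v).

(** An edge of [M] has some end [v], where [f v] is also an edge of [M]; the matching leaves room
    for only one of them. *)
Lemma edge_choice_perfect_matching (M : {set edge G}) :
  perfect_matching M -> (forall v, f v \in M) -> M = f @: setT.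
Proof.
move=> pmM fM; apply/setP=> e; apply/idP/imsetP=> [eM | [v _ ->] //].
have /andP[/card_gt0P[v ve] _] := ends_card e.
by exists v => //; apply: perfect_matching_uniq pmM eM (fM v) ve (f_inc v).
Qed.

Lemma edge_choice_fiber_sub e : f @^-1: [set e] \subset ends e.
Proof. by apply/subsetP=> v; rewrite !inE => /eqP <-. Qed.

(** In a matching, both ends of a chosen edge must choose it. Conversely, a nonempty fiber of even
    size has at least two elements and lies in a set of at most two ends, so it is the whole set of
    ends; this also excludes loops. *)
Lemma perfect_matching_fibers_even :
  perfect_matching (f @: setT) = [forall e, ~~ odd #|f @^-1: [set e]|].
Proof.
apply/idP/forallP=> [pm e | fib_even].
  have [eM | eM] := boolP (e \in f @: setT).
    suff -> : f @^-1: [set e] = ends e by rewrite (perfect_matching_card_ends pm).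
    apply/eqP; rewrite eqEsubset edge_choice_fiber_sub; apply/subsetP=> v ve.
    rewrite !inE; apply/eqP.
    exact: perfect_matching_uniq pm (imset_f _ (in_setT v)) eM (f_inc v) ve.
  suff -> : f @^-1: [set e] = set0 by rewrite cards0.
  apply/setP=> v; rewrite !inE; apply: contraNF eM => /eqP <-.
  exact: imset_f.
have fiberE w : f @^-1: [set f w] = ends (f w) /\ #|ends (f w)| = 2%N.
  have sub := edge_choice_fiber_sub (f w).
  have /andP[_ le2] := ends_card (f w).
  have gt0 : (0 < #|f @^-1: [set f w]|)%N.
    by apply/card_gt0P; exists w; rewrite !inE.
  have le := subset_leq_card sub.
  have ge2 : (2 <= #|f @^-1: [set f w]|)%N.
    by move: gt0 (fib_even (f w)); case: #|_| => [|[|k]].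
  split; first by apply/eqP; rewrite eqEcard sub (leq_trans le2).
  by apply/eqP; rewrite eqn_leq le2 (leq_trans ge2).
apply/forallP=> v; rewrite /degree_in (bigD1 (f v)) ?imset_f //=.
rewrite big1 ?addn0 => [|e /andP[/imsetP[w _ ->] neq]].
  by rewrite /incidence f_inc (fiberE v).2.
rewrite /incidence; case: ifP => // vw.
by move: vw neq; rewrite -(fiberE w).1 !inE => /eqP ->; rewrite eqxx.
Qed.

End EdgeChoice.

Definition color_sign (G : graph) (c : coloring G) (e : edge G) : rat :=
  (-1) ^+ c e.

Section Coloring.
Variable G : graph.

Lemma degree_in_color (c : coloring G) v k :
  degree_in [set e | c e == k] v = (\sum_(e | c e == k) incidence v e)%N.
Proof. by apply: eq_bigl => e; rewrite inE. Qed.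

(** The multiplicity [incidence v e] turns a sum over all edges into one over the edge-ends at [v]:
    edges away from [v] count 0, loops count twice. *)
Lemma sum_color_sign (c : coloring G) v :
  \sum_e color_sign c e *+ incidence v e =
  (degree_in [set e | c e == false] v)%:R
  - (degree_in [set e | c e == true] v)%:R.
Proof.
rewrite (bigID (fun e => c e == false)) /= !degree_in_color !natr_sum -sumrN.
congr (_ + _).
  by apply: eq_bigr => e /eqP ce; rewrite /color_sign ce.
apply: eq_big => [e | e]; first by case: (c e).
by rewrite /color_sign; case: (c e) => //= _; rewrite expr1 mulNrn.
Qed.

Lemma prod_color_sign (c : coloring G) v :
  \prod_e color_sign c e ^+ incidence v e =
  (-1) ^+ degree_in [set e | c e == true] v.
Proof.
rewrite (bigID (fun e => c e == true)) /= degree_in_color -prodrXr.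
rewrite [X in _ * X]big1 ?mulr1 => [|e]; last first.
  by rewrite /color_sign; case: (c e) => // _; rewrite expr0 expr1n.
by apply: eq_bigr => e /eqP ce; rewrite /color_sign ce expr1.
Qed.

Lemma degree_colorE (c : coloring G) v :
  (degree_in [set e | c e == false] v + degree_in [set e | c e == true] v)%N =
  degree v.
Proof.
rewrite !degree_in_color /degree /degree_in.
rewrite [RHS](bigID (fun e => c e == false)) /=.
congr (_ + _)%N; first by apply: eq_bigl => e; rewrite inE.
by apply: eq_bigl => e; rewrite inE; case: (c e).
Qed.

Lemma vertex_weightE (c : coloring G) v : degree v = 3%N ->
  (if monochromatic c v then - 3%:R else 1) =
  - ((\prod_e color_sign c e ^+ incidence v e)
     * \sum_e color_sign c e *+ incidence v e).
Proof.
move=> deg3; rewrite sum_color_sign prod_color_sign.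
have := degree_colorE c v; rewrite deg3.
have -> : monochromatic c v =
    (degree_in [set e | c e == false] v == 3%N)
    || (degree_in [set e | c e == true] v == 3%N).
  apply/existsP/orP => [[[] ?]|[?|?]]; [by right|by left|..].
    by exists false.
  by exists true.
(* The two color degrees add up to 3, so only four pairs survive, each settled by computation. *)
case: (degree_in _ v) => [|[|[|[|a]]]];
  by case: (degree_in _ v) => [|[|[|[|b]]]].
Qed.

Lemma prod_color_sign_ends (c : coloring G) :
  \prod_v \prod_e color_sign c e ^+ incidence v e = 1.
Proof.
rewrite exchange_big big1 //= => e _.
by rewrite prodrXr sum_incidence /color_sign -exprM mulnC exprM sqrrN !expr1n.
Qed.

Lemma monochromatic_weightE (c : coloring G) :
    cubic G -> ~~ odd #|vertex G| ->
  (- 3%:R) ^+ num_monochromatic c =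
  \prod_v \sum_e color_sign c e *+ incidence v e.
Proof.
move=> cubG evenG; rewrite /num_monochromatic cardsE -prodr_const.
rewrite big_mkcond /=.
under eq_bigr => v _.
  rewrite unfold_in (vertex_weightE c (cubG v)) -mulN1r.
  over.
rewrite big_split big_split /= prod_color_sign_ends mul1r prodr_const.
by rewrite -signr_odd (negbTE evenG) mul1r.
Qed.

(** Edges are colored independently, so the sum factors over the edges; an edge chosen [k e] times
    contributes [1 + (-1) ^+ k e], which is 2 or 0. *)
Lemma sum_prod_color_sign (f : {ffun vertex G -> edge G}) :
  \sum_(c : coloring G) \prod_v color_sign c (f v) =
  #|coloring G|%:R * [forall e, ~~ odd #|f @^-1: [set e]|]%:R.
Proof.
pose k e := #|f @^-1: [set e]|.
transitivity (\sum_(c : coloring G) \prod_e ((-1) ^+ c e) ^+ k e : rat).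
  apply: eq_bigr => c _; rewrite (partition_big f predT) //=.
  apply: eq_bigr => e _; rewrite /k -prodr_const.
  by apply: eq_big => [v | v /eqP <- //]; rewrite !inE.
rewrite -(bigA_distr_bigA (fun e (b : bool) => ((-1) ^+ b) ^+ k e : rat)) /=.
under eq_bigr => e _ do
  rewrite big_bool /= expr1 expr0 expr1n -signr_odd.
rewrite card_ffun card_bool.
case: forallP => [even_k | not_even].
  rewrite mulr1 natrX -prodr_const; apply: eq_bigr => e _.
  by rewrite (negbTE (even_k e)).
rewrite mulr0; have /existsP[e odd_e] : [exists e, odd (k e)].
  by apply: contraT => /existsPn.
by rewrite (bigD1 e) //= odd_e expr1 addNr mul0r.
Qed.

(** Double counting of pairs of a perfect matching [M] and a choice [f] of edges in [M], weighted by
    incidences. For fixed [M] the weights add up to a product of degrees, all 1; for fixed [f] only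
    the image of [f] can serve as [M]. *)
Lemma PerMat_edge_choices :
  PerMat G = (\sum_(f : {ffun vertex G -> edge G})
    (\prod_v incidence v (f v)) *
      [forall e, ~~ odd #|f @^-1: [set e]|])%N.
Proof.
rewrite /PerMat cardsE -sum1_card.
transitivity (\sum_(M | perfect_matching M)
  \sum_(f : {ffun vertex G -> edge G} | [forall v, f v \in M])
    \prod_v incidence v (f v))%N.
  apply: eq_bigr => M pmM.
  transitivity (\prod_v \sum_(e in M) incidence v e)%N.
    by rewrite big1 // => v _; exact/eqP/(forallP pmM v).
  rewrite bigA_distr_big; apply: eq_bigl => f.
  by apply/ffun_onP/forallP.
rewrite (exchange_big_dep predT) //=; apply: eq_bigr => f _.
(* A choice of an edge not incident with its vertex has weight 0. *)
have [f_inc | /forallPn[v vf]] := boolP [forall v, v \in ends (f v)]; last first.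
  have prod0 : (\prod_v incidence v (f v) = 0)%N.
    by rewrite (bigD1 v) //= /incidence (negbTE vf).
  by rewrite prod0 big1.
have {}f_inc v : v \in ends (f v) by move/forallP: f_inc.
rewrite sum_nat_const mulnC -(perfect_matching_fibers_even f_inc).
congr (_ * _)%N.
have [pm | not_pm] := boolP (perfect_matching (f @: setT)).
  apply: (@eq_card1 _ (f @: setT)) => M; rewrite !inE unfold_in.
  apply/andP/eqP => [[pmM /forallP fM] | ->].
    exact: edge_choice_perfect_matching.
  by split=> //; apply/forallP=> v; apply: imset_f.
apply: eq_card0 => M; rewrite unfold_in /=; apply: contraNF not_pm.
move=> /andP[pmM /forallP fM].
by rewrite -(edge_choice_perfect_matching f_inc pmM fM).
Qed.

End Coloring.

Theorem theorem1p6 (G : graph) (n : nat)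
    (order_G : #|vertex G| = (2 * n)%N) (cubic_G : cubic G) :
  (PerMat G)%:R =
  uniform_expectation (fun c : coloring G => (- 3%:R) ^+ num_monochromatic c).
Proof.
have evenG : ~~ odd #|vertex G| by rewrite order_G mul2n odd_double.
rewrite /uniform_expectation.
under eq_bigr => c _ do
  rewrite (monochromatic_weightE c cubic_G evenG) bigA_distr_bigA /=.
rewrite exchange_big /= PerMat_edge_choices natr_sum mulr_suml.
apply: eq_bigr => f _.
(* The incidences do not depend on the coloring and leave the sum over [c]. *)
under [in RHS]eq_bigr => c _ do
  (under eq_bigr => v _ do rewrite -mulr_natr; rewrite big_split /=).
rewrite -mulr_suml sum_prod_color_sign natrM natr_prod.
have card_neq0 : (#|coloring G|%:R : rat) != 0.
  by rewrite pnatr_eq0 card_ffun card_bool expn_eq0.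
by rewrite -[X in X / _]mulrA [RHS]mulrAC divff // mul1r mulrC.
Qed.
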